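(* Let $n$ be an integer larger than $1$. Let $R$ be a rectangular diagram of a link with $n$ vertical edges. Then $R$ has at most $(n^2-2n-1)/2$ crossings when $n$ is odd, and at most $(n^2-2n)/2$ crossings when $n$ is even. The sum of the lengths of the edges of $R$ (over all vertical and horizontal edges) is at most $n^2-1$ when $n$ is odd, and at most $n^2$ when $n$ is even.
   Context: A rectangular diagram of a link is a link diagram in the plane $\mathbb{R}^2$ composed of vertical line segments and horizontal line segments (called edges), such that no two vertical edges are colinear, no two horizontal edges are colinear, and at each crossing the vertical edge passes over the horizontal edge. It has equally many vertical and horizontal edges. A horizontal (resp. vertical) edge is of length $|j-i|$ if it connects the $i$-th and the $j$-th vertical (resp. horizontal) edges counted from the left (resp. from the bottom). *)

(* Defs.v *)
From HB Require Import structures.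
From mathcomp Require Import all_boot all_order all_algebra.
From mathcomp Require Import reals.

Set Implicit Arguments.
Unset Strict Implicit.
Unset Printing Implicit Defensive.

Import Order.TTheory GRing.Theory Num.Theory.
Local Open Scope ring_scope.

(* The same record serves for both directions: as a vertical segment it is
   {pos} x [lo, hi], as a horizontal segment it is [lo, hi] x {pos}. *)
Record segment (K : realType) := Segment {
  pos : K;
  lo : K;
  hi : K;
  lo_lt_hi : lo < hi }.

Section Endpoints.
Context {K : realType}.

Definition bottom (s : segment K) : K * K := (pos s, lo s).
Definition top (s : segment K) : K * K := (pos s, hi s).
Definition left_end (s : segment K) : K * K := (lo s, pos s).
Definition right_end (s : segment K) : K * K := (hi s, pos s).

Definition vertical_ends (s : segment K) : seq (K * K) :=
  [:: bottom s; top s].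
Definition horizontal_ends (s : segment K) : seq (K * K) :=
  [:: left_end s; right_end s].

End Endpoints.

(* The segments form closed curves: every endpoint of an edge is a corner where
   exactly one vertical and exactly one horizontal edge meet. By the
   non-colinearity conditions, an endpoint of an edge never lies in the interior
   of another edge, and no three edges share a point, so the only other
   intersections are transverse double points. Nothing is recorded about
   over- and underpasses, because the vertical edge always passes over. The
   equality #|vedge| = #|hedge| is a consequence and is not required. *)
Record rect_diagram (K : realType) := RectDiagram {
  vedge : finType;
  hedge : finType;
  vseg : vedge -> segment K;
  hseg : hedge -> segment K;
  vedge_noncolinear : injective (fun v => pos (vseg v));
  hedge_noncolinear : injective (fun h => pos (hseg h));
  vertical_ends_meet : forall (v : vedge) (p : K * K),
    p \in vertical_ends (vseg v) ->
    exists! h : hedge, p \in horizontal_ends (hseg h);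
  horizontal_ends_meet : forall (h : hedge) (p : K * K),
    p \in horizontal_ends (hseg h) ->
    exists! v : vedge, p \in vertical_ends (vseg v) }.

Section RectangularDiagram.
Context {K : realType} (D : rect_diagram K).

(* A crossing is identified with its pair (over-strand, under-strand); distinct
   pairs cross at distinct points (pos v, pos h). *)
Definition crossings : {set vedge D * hedge D} :=
  [set c | (lo (hseg c.2) < pos (vseg c.1) < hi (hseg c.2)) &&
           (lo (vseg c.1) < pos (hseg c.2) < hi (vseg c.1))].

(* v is the (vrank v)-th vertical edge from the left and h the (hrank h)-th
   horizontal edge from the bottom, counting from 1. *)
Definition vrank (v : vedge D) : nat :=
  #|[set w : vedge D | pos (vseg w) <= pos (vseg v)]|.
Definition hrank (h : hedge D) : nat :=
  #|[set k : hedge D | pos (hseg k) <= pos (hseg h)]|.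

(* In both definitions below the pair exists and is unique by the closedness
   conditions of [rect_diagram], so the default value 0 is never used. *)
Definition hlength (h : hedge D) : nat :=
  if [pick e : vedge D * vedge D |
       (left_end (hseg h) \in vertical_ends (vseg e.1)) &&
       (right_end (hseg h) \in vertical_ends (vseg e.2))] is Some e
  then `|(vrank e.2)%:Z - (vrank e.1)%:Z|%N else 0%N.

Definition vlength (v : vedge D) : nat :=
  if [pick e : hedge D * hedge D |
       (bottom (vseg v) \in horizontal_ends (hseg e.1)) &&
       (top (vseg v) \in horizontal_ends (hseg e.2))] is Some e
  then `|(hrank e.2)%:Z - (hrank e.1)%:Z|%N else 0%N.

Definition total_length : nat :=
  (\sum_(v : vedge D) vlength v + \sum_(h : hedge D) hlength h)%N.

End RectangularDiagram.

(* Main.v *)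
(* Corners give a bijection between the ends of horizontal edges and the ends
   of vertical edges, so every vertical edge is hit by exactly two horizontal
   ends. Measuring each horizontal edge through the median rank [n./2] by the
   triangle inequality therefore bounds the sum of the horizontal lengths by
   [2 * \sum_(i < n) |i - n./2| = n ^ 2 %/ 2]; reflecting the diagram in the main
   diagonal gives the same bound for the vertical edges. A horizontal edge of
   length [l] has at most [l - 1] crossings, whence the number of crossings is
   at most [n ^ 2 %/ 2 - n]. *)
Require Import Defs.
From mathcomp Require Import all_boot all_order all_algebra.
From mathcomp Require Import reals.
From mathcomp Require Import zify.

Set Implicit Arguments.
Unset Strict Implicit.
Unset Printing Implicit Defensive.

Import Order.TTheory.

Lemma leq_sum_inj (I J : finType) (f : I -> J) (F : J -> nat) :
  injective f -> \sum_i F (f i) <= \sum_j F j.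
Proof.
move=> f_inj.
rewrite -(big_imset (A := I) F) /=; last by move=> i j _ _ /f_inj.
by rewrite [leqRHS](bigID (mem (f @: I))) leq_addr.
Qed.

(** Induction in steps of two: without its first and last terms, the sum for [n.+2] is the sum for
    [n], since the index and the midpoint both shift by one. The two removed terms add up to
    [n + 1]. *)
Lemma sum_dist_half n :
  2 * (\sum_(i < n) `|i - n./2|%N) = n ^ 2 %/ 2.
Proof.
have [m] := ubnP n; elim: m n => // m IHm [|[|n]] lt_nm.
- by rewrite big_ord0.
- by rewrite big_ord1.
rewrite big_ord_recl big_ord_recr /=.
rewrite (eq_bigr (fun i : 'I_n => `|i - n./2|%N)); last first.
  by move=> i _; rewrite /bump /=; lia.
have := IHm n ltac:(lia).
set S := \sum_(i < n) _ => IHn.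
have -> : n.+2 ^ 2 = n ^ 2 + (2 * n + 2) * 2 by rewrite -!mulnn; lia.
by rewrite divnDMl // -IHn /bump /=; lia.
Qed.

Section Corners.
Context {K : realType}.
Implicit Types (s : segment K) (D : rect_diagram K).

(** A Boolean label for ends turns the ends of all edges into the finite types [vedge D * bool] and
    [hedge D * bool]. *)
Definition vertical_end s (b : bool) := if b then top s else bottom s.
Definition horizontal_end s (b : bool) := if b then right_end s else left_end s.

Lemma vertical_endP s p :
  reflect (exists b, p = vertical_end s b) (p \in vertical_ends s).
Proof.
rewrite !inE; apply: (iffP orP) => [[/eqP->|/eqP->]|[[] ->]].
- by exists false.
- by exists true.
- by right.
- by left.
Qed.

Lemma horizontal_endP s p :
  reflect (exists b, p = horizontal_end s b) (p \in horizontal_ends s).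
Proof.
rewrite !inE; apply: (iffP orP) => [[/eqP->|/eqP->]|[[] ->]].
- by exists false.
- by exists true.
- by right.
- by left.
Qed.

Lemma horizontal_end_inj s : injective (horizontal_end s).
Proof.
by move=> [] [] //= [] lohi; have := lo_lt_hi s; rewrite lohi ltxx.
Qed.

Lemma vertical_end_pos s p : p \in vertical_ends s -> pos s = p.1.
Proof. by rewrite !inE => /orP[] /eqP->. Qed.

Definition swap (p : K * K) := (p.2, p.1).

Lemma swapK : involutive swap. Proof. by case. Qed.

Lemma swap_horizontal_ends s p :
  (swap p \in horizontal_ends s) = (p \in vertical_ends s).
Proof. by case: p => x y; rewrite !inE /swap !xpair_eqE /= ![(y == _) && _]andbC. Qed.

Lemma swap_vertical_ends s p :
  (swap p \in vertical_ends s) = (p \in horizontal_ends s).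
Proof. by rewrite -swap_horizontal_ends swapK. Qed.

Lemma transpose_vertical_ends_meet D (h : hedge D) p :
  p \in vertical_ends (hseg h) ->
  exists! v : vedge D, p \in horizontal_ends (vseg v).
Proof.
rewrite -swap_horizontal_ends => /horizontal_ends_meet[v [pv uv]].
exists v; split=> [|w]; first by rewrite -swap_vertical_ends.
by rewrite -swap_vertical_ends => /uv.
Qed.

Lemma transpose_horizontal_ends_meet D (v : vedge D) p :
  p \in horizontal_ends (vseg v) ->
  exists! h : hedge D, p \in vertical_ends (hseg h).
Proof.
rewrite -swap_vertical_ends => /vertical_ends_meet[h [ph uh]].
exists h; split=> [|k]; first by rewrite -swap_horizontal_ends.
by rewrite -swap_horizontal_ends => /uh.
Qed.

Definition transpose D : rect_diagram K :=
  RectDiagram (@hedge_noncolinear _ D) (@vedge_noncolinear _ D)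
    (@transpose_vertical_ends_meet D) (@transpose_horizontal_ends_meet D).

Lemma vlength_transpose D (v : vedge D) :
  vlength v = @hlength K (transpose D) v.
Proof.
rewrite /vlength /hlength; set p := pick _; set q := pick _.
suff -> : p = q by [].
apply: eq_pick => -[h k] /=.
(* Up to [swap], both picks test the same predicate, hence return the same pair. *)
by rewrite -[left_end _]/(swap (bottom (vseg v)))
  -[right_end _]/(swap (top (vseg v))) !swap_vertical_ends.
Qed.

(** Ends with the same image are the same point. Only one horizontal edge ends there, and its two
    ends are distinct, which gives injectivity. *)
Lemma corner_map D : exists2 f : hedge D * bool -> vedge D * bool,
  injective f & forall x,
    horizontal_end (hseg x.1) x.2 = vertical_end (vseg (f x).1) (f x).2.
Proof.
have corner (x : hedge D * bool) : exists y : vedge D * bool,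
    horizontal_end (hseg x.1) x.2 = vertical_end (vseg y.1) y.2.
  have [|v [/vertical_endP[b eb] _]] :=
    @horizontal_ends_meet K D x.1 (horizontal_end (hseg x.1) x.2).
    by apply/horizontal_endP; exists x.2.
  by exists (v, b).
have [f fP] := fin_all_exists corner; exists f => // -[h b] [k c] eqf.
have := fP (h, b); rewrite eqf -fP /= => eqhk.
have [|g [_ ug]] := @vertical_ends_meet K D (f (h, b)).1 (horizontal_end (hseg h) b).
  by apply/vertical_endP; exists (f (h, b)).2; rewrite -fP.
have gh : g = h by apply: ug; apply/horizontal_endP; exists b.
have gk : g = k by apply: ug; apply/horizontal_endP; exists c.
by move: eqhk; rewrite -gh -gk => /horizontal_end_inj->.
Qed.

Lemma card_hedge_le D : #|hedge D| <= #|vedge D|.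
Proof.
have [f f_inj _] := corner_map D.
by have := leq_card f f_inj; rewrite !card_prod card_bool leq_pmul2r.
Qed.

(** Only one vertical edge ends at each corner, so [pick] can return no pair other than [(v, w)]. *)
Lemma hlengthE D (h : hedge D) (v w : vedge D) :
  left_end (hseg h) \in vertical_ends (vseg v) ->
  right_end (hseg h) \in vertical_ends (vseg w) ->
  hlength h = `|vrank w - vrank v|%N.
Proof.
move=> hv hw; rewrite /hlength; case: pickP => [[v' w'] /=|/(_ (v, w))].
  case/andP=> hv' hw'.
  have [|? [_ uv]] := @horizontal_ends_meet K D h (left_end (hseg h)).
    by rewrite inE eqxx.
  have [|? [_ uw]] := @horizontal_ends_meet K D h (right_end (hseg h)).
    by rewrite !inE eqxx orbT.
  by rewrite -(uv _ hv) -(uv _ hv') -(uw _ hw) -(uw _ hw').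
by rewrite /= hv hw.
Qed.

Lemma vrank_gt0 D (v : vedge D) : 0 < vrank v.
Proof. by apply/card_gt0P; exists v; rewrite inE lexx. Qed.

Lemma ltn_vrank D (v w : vedge D) :
  (pos (vseg v) < pos (vseg w))%R -> vrank v < vrank w.
Proof.
move=> lt_vw; apply/proper_card/properP; split.
  by apply/subsetP=> u; rewrite !inE => /le_trans-> //; apply: ltW.
by exists w; rewrite !inE ?lexx // -ltNge.
Qed.

Lemma vrank_inj D : injective (@vrank K D).
Proof.
move=> v w eq_vw; apply: (@vedge_noncolinear K D).
by case: (ltgtP (pos (vseg v)) (pos (vseg w))) => // /ltn_vrank; rewrite eq_vw ltnn.
Qed.

Lemma sum_vrank_dist D :
  2 * (\sum_(v : vedge D) `|(vrank v).-1 - #|vedge D|./2|%N)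
    <= #|vedge D| ^ 2 %/ 2.
Proof.
(* Ranks start from 1 and ordinals from 0, hence the predecessor. *)
have lt_rank v : (@vrank K D v).-1 < #|vedge D|.
  by rewrite prednK ?vrank_gt0 ?max_card.
rewrite -sum_dist_half leq_mul2l /=.
apply: (@leq_sum_inj _ _ (fun v => Ordinal (lt_rank v))
  (fun i : 'I_#|vedge D| => `|i - #|vedge D|./2|%N)).
move=> v w [eq_vw]; apply: vrank_inj.
by rewrite -(prednK (vrank_gt0 v)) eq_vw prednK ?vrank_gt0.
Qed.

Lemma sum_hlength_le D : \sum_(h : hedge D) hlength h <= #|vedge D| ^ 2 %/ 2.
Proof.
have [f f_inj fP] := corner_map D; apply: leq_trans (sum_vrank_dist D).
pose F (y : vedge D * bool) := `|(vrank y.1).-1 - #|vedge D|./2|%N.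
(* The factor 2 counts the two ends of each vertical edge. *)
have -> : 2 * (\sum_(v : vedge D) `|(vrank v).-1 - #|vedge D|./2|%N)
    = \sum_y F y.
  rewrite -(pair_bigA _ (fun v b => F (v, b))) big_distrr /=.
  by apply: eq_bigr => v _; rewrite big_bool mul2n -addnn.
apply: leq_trans (leq_sum_inj F f_inj).
have -> : \sum_x F (f x) = \sum_h \sum_b F (f (h, b)).
  by rewrite pair_bigA; apply: eq_bigr => -[].
apply: leq_sum => h _; rewrite big_bool /=.
rewrite (@hlengthE _ _ (f (h, false)).1 (f (h, true)).1).
(* Positive ranks keep the predecessors from truncating; what remains is the triangle inequality
   through the midpoint. *)
- have := vrank_gt0 (f (h, false)).1; have := vrank_gt0 (f (h, true)).1.
  by rewrite /F; lia.
- by apply/vertical_endP; exists (f (h, false)).2; rewrite -fP.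
- by apply/vertical_endP; exists (f (h, true)).2; rewrite -fP.
Qed.

Lemma edge_crossings_lt D (h : hedge D) :
  #|[set v | (v, h) \in crossings D]| < hlength h.
Proof.
have [|v [hv _]] := @horizontal_ends_meet K D h (left_end (hseg h)).
  by rewrite inE eqxx.
have [|w [hw _]] := @horizontal_ends_meet K D h (right_end (hseg h)).
  by rewrite !inE eqxx orbT.
rewrite (hlengthE hv hw).
have {hv}posv := vertical_end_pos hv; have {hw}posw := vertical_end_pos hw.
set A := [set _ | _].
pose B := [set u : vedge D | (pos (vseg u) <= pos (vseg v))%R].
have AB0 : [disjoint A & B].
  rewrite -setI_eq0; apply/eqP/setP=> u; rewrite !inE posv /=.
  by case: leP; rewrite ?andbF //= andbT.
(* [B] has [vrank v] elements and the set on the right has [vrank w]. The edge [w] at the right end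
   lies in neither [A] nor [B], which makes the bound strict. *)
have : A :|: B \proper [set u : vedge D | (pos (vseg u) <= pos (vseg w))%R].
  apply/properP; split.
    apply/subsetP=> u; rewrite !inE posv posw /=.
    case/orP=> [/andP[/andP[_ /ltW//]]|/le_trans-> //].
    exact/ltW/lo_lt_hi.
  exists w; rewrite !inE ?lexx // posv posw /= ltxx andbF /= -ltNge.
  exact: lo_lt_hi.
move/proper_card; rewrite cardsU (disjoint_setI0 AB0) cards0 subn0.
by rewrite -/(vrank w) -/(vrank v); lia.
Qed.

Lemma crossings_sum_hlength D :
  #|crossings D| + #|hedge D| <= \sum_(h : hedge D) hlength h.
Proof.
have -> : #|crossings D| =
    \sum_(h : hedge D) #|[set v | (v, h) \in crossings D]|.
  (* The crossings are grouped by their horizontal edge. *)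
  rewrite -sum1_card (eq_bigl (fun c => (c.1, c.2) \in crossings D)).
    rewrite -(pair_big_dep xpredT (fun v h => (v, h) \in crossings D)
      (fun _ _ => 1)) /= (exchange_big_dep xpredT) //=.
    by apply: eq_bigr => h _; rewrite -sum1_card; apply: eq_bigl => v; rewrite !inE.
  by case.
rewrite -sum1_card -big_split /=; apply: leq_sum => h _.
by rewrite addn1 edge_crossings_lt.
Qed.

End Corners.

Theorem proposition1p4 (n : nat) (hn : 1 < n) (K : realType)
    (D : rect_diagram K) (hD : #|vedge D| = n) :
  (odd n -> #|crossings D| <= (n ^ 2 - 2 * n - 1) %/ 2) /\
  (~~ odd n -> #|crossings D| <= (n ^ 2 - 2 * n) %/ 2) /\
  (odd n -> total_length D <= n ^ 2 - 1) /\
  (~~ odd n -> total_length D <= n ^ 2).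
Proof.
(* The corner injections of [D] and of its transpose give the two inequalities. *)
have hH : #|hedge D| = n.
  apply/eqP; rewrite eqn_leq -{1}hD card_hedge_le -hD.
  exact: (card_hedge_le (transpose D)).
have cr := crossings_sum_hlength D; have hl := sum_hlength_le D.
have vl : \sum_(v : vedge D) vlength v <= n ^ 2 %/ 2.
  rewrite -hH (eq_bigr _ (fun v _ => vlength_transpose v)).
  exact: (sum_hlength_le (transpose D)).
(* Parity decides whether [n ^ 2 %/ 2] loses a half: twice it is [n ^ 2 - 1] for odd [n] and [n ^ 2]
   for even [n]. *)
have odd_sq : odd (n ^ 2) = odd n by rewrite oddX.
rewrite /total_length; move: cr hl vl odd_sq; rewrite hH hD.
by do !split; lia.
Qed.
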